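(* In the homogeneous setting $\beta_{SR,k}=\beta_{RD,k}=1$ for all $k=1,\dots,K$, with $\sigma_{LI}^2>0$ and all parameters other than $p_R$ fixed, the optimal relay transmit power, i.e. the maximizer of $\sum_{k=1}^K\tilde R_k$ over $p_R\ge0$ (with $\tilde R_k$ as defined in the context), is $$p_R^*=\sqrt{\frac{\alpha p_SK}{\sigma_{LI}^2}}.$$
   Context: $\tilde R_k$ is the (large-antenna approximated) rate of the $k$-th of $K$ users in a relaying system with $M\ge1$ relay antennas and low-resolution ADCs at relay (parameter $\alpha\in(0,1]$) and destinations (parameter $\theta\in(0,1]$). Parameters: $p_S,p_R,p_p>0$, $\tau_c>2\tau_p>0$, $\sigma_{LI}^2>0$, $\beta_{SR,i},\beta_{RD,i}>0$, and $\sigma_{SR,i}^2=\frac{\alpha\tau_pp_p\beta_{SR,i}^2}{1+\tau_pp_p\beta_{SR,i}}$, $\sigma_{RD,i}^2=\frac{\alpha\tau_pp_p\beta_{RD,i}^2}{1+\tau_pp_p\beta_{RD,i}}$ for $i=1,\dots,K$. By definition, for $p_R>0$, $$\tilde R_k=\frac{\tau_c-2\tau_p}{\tau_c}\log_2\left(1+\frac{\tilde A_k}{\tilde B_k+\tilde C_k+\tilde D_k+\tilde E_k+\tilde F_k+\tilde G_k+\tilde H_k}\right)$$ and $\tilde R_k=0$ at $p_R=0$ (its limit as $p_R\to0$), with - $\tilde A_k=p_SM\sigma_{SR,k}^2\sigma_{RD,k}^2$; - $\tilde B_k=p_S(\beta_{SR,k}\sigma_{RD,k}^2+\beta_{RD,k}\sigma_{SR,k}^2)$;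 - $\tilde C_k=p_S\sum_{j\ne k}\Big(\sigma_{RD,k}^2\beta_{SR,j}+\frac{\beta_{RD,k}\sigma_{SR,j}^4\sigma_{RD,j}^2}{\sigma_{SR,k}^2\sigma_{RD,k}^2}\Big)$; - $\tilde D_k=p_R\sigma_{LI}^2\sigma_{RD,k}^2$; $\tilde E_k=\sigma_{RD,k}^2$; - $\tilde F_k=\frac{1-\alpha}{\alpha}\sigma_{RD,k}^2\big(p_S(\sigma_{SR,k}^2+\sum_{i=1}^K\beta_{SR,i})+p_R\sigma_{LI}^2+1\big)$; - $\tilde G_k=\frac{p_S}{p_R\sigma_{SR,k}^2\sigma_{RD,k}^2}\sum_{i=1}^K\sigma_{SR,i}^4\sigma_{RD,i}^2$; - $\tilde H_k=\frac{1-\theta}{\theta}p_S\Big(M\sigma_{SR,k}^2\sigma_{RD,k}^2+\frac{\sigma_{SR,k}^2\beta_{RD,k}}{\sigma_{RD,k}^2}\sum_{i=1}^K\sigma_{RD,i}^2\Big)+\frac{1-\theta}{\theta}p_S\sigma_{RD,k}^2\Big(\sum_{i=1}^K\beta_{SR,i}+\frac{p_R\sigma_{LI}^2+1}{\alpha p_S}\Big)+\frac{(1-\alpha)(1-\theta)}{\alpha\theta}\sigma_{RD,k}^2p_S\Big(\sigma_{SR,k}^2+\sum_{i=1}^K\beta_{SR,i}\Big)+\frac{(1-\theta)p_S\sum_{i=1}^K\sigma_{SR,i}^4\sigma_{RD,i}^2}{\theta p_R\sigma_{SR,k}^2\sigma_{RD,k}^2}$. *)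

(* Defs.v *)
From HB Require Import structures.
From mathcomp Require Import all_boot all_order all_algebra.
From mathcomp Require Import all_classical all_reals all_analysis.

Set Implicit Arguments.
Unset Strict Implicit.
Unset Printing Implicit Defensive.

Import Order.TTheory GRing.Theory Num.Theory.

Local Open Scope ring_scope.

(* The system parameters other than the relay power p_R.  Fields and functions
   whose name ends in 2 denote the squared quantities: sigmaLI2 is sigma_LI^2,
   and below sigma_SR^4 is written sigmaSR2 ^+ 2. *)
Record relay_system (R : realType) (K : nat) := RelaySystem {
  M : nat;
  alpha : R;
  theta : R;
  pS : R;
  pp : R;
  tauc : R;
  taup : R;
  sigmaLI2 : R;
  betaSR : 'I_K -> R;
  betaRD : 'I_K -> R;
  K_ge1 : (1 <= K)%N;
  M_ge1 : (1 <= M)%N;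
  alpha_range : 0 < alpha <= 1;
  theta_range : 0 < theta <= 1;
  pS_gt0 : 0 < pS;
  pp_gt0 : 0 < pp;
  taup_gt0 : 0 < taup;
  tauc_gt : 2 * taup < tauc;
  sigmaLI2_gt0 : 0 < sigmaLI2;
  betaSR_gt0 : forall i, 0 < betaSR i;
  betaRD_gt0 : forall i, 0 < betaRD i
}.

Definition log2 (R : realType) (x : R) : R := ln x / ln 2.

Definition sigmaSR2 (R : realType) (K : nat) (S : relay_system R K)
    (i : 'I_K) : R :=
  alpha S * taup S * pp S * betaSR S i ^+ 2 / (1 + taup S * pp S * betaSR S i).

Definition sigmaRD2 (R : realType) (K : nat) (S : relay_system R K)
    (i : 'I_K) : R :=
  alpha S * taup S * pp S * betaRD S i ^+ 2 / (1 + taup S * pp S * betaRD S i).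

Definition termA (R : realType) (K : nat) (S : relay_system R K)
    (k : 'I_K) : R :=
  pS S * (M S)%:R * sigmaSR2 S k * sigmaRD2 S k.

Definition termB (R : realType) (K : nat) (S : relay_system R K)
    (k : 'I_K) : R :=
  pS S * (betaSR S k * sigmaRD2 S k + betaRD S k * sigmaSR2 S k).

Definition termC (R : realType) (K : nat) (S : relay_system R K)
    (k : 'I_K) : R :=
  pS S * \sum_(j < K | j != k)
    (sigmaRD2 S k * betaSR S j
     + betaRD S k * sigmaSR2 S j ^+ 2 * sigmaRD2 S j
       / (sigmaSR2 S k * sigmaRD2 S k)).

Definition termD (R : realType) (K : nat) (S : relay_system R K)
    (pR : R) (k : 'I_K) : R :=
  pR * sigmaLI2 S * sigmaRD2 S k.

Definition termE (R : realType) (K : nat) (S : relay_system R K)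
    (k : 'I_K) : R :=
  sigmaRD2 S k.

Definition termF (R : realType) (K : nat) (S : relay_system R K)
    (pR : R) (k : 'I_K) : R :=
  (1 - alpha S) / alpha S * sigmaRD2 S k
  * (pS S * (sigmaSR2 S k + \sum_(i < K) betaSR S i) + pR * sigmaLI2 S + 1).

Definition termG (R : realType) (K : nat) (S : relay_system R K)
    (pR : R) (k : 'I_K) : R :=
  pS S / (pR * sigmaSR2 S k * sigmaRD2 S k)
  * \sum_(i < K) (sigmaSR2 S i ^+ 2 * sigmaRD2 S i).

Definition termH (R : realType) (K : nat) (S : relay_system R K)
    (pR : R) (k : 'I_K) : R :=
  (1 - theta S) / theta S * pS S
    * ((M S)%:R * sigmaSR2 S k * sigmaRD2 S k
       + sigmaSR2 S k * betaRD S k / sigmaRD2 S k * \sum_(i < K) sigmaRD2 S i)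
  + (1 - theta S) / theta S * pS S * sigmaRD2 S k
    * (\sum_(i < K) betaSR S i + (pR * sigmaLI2 S + 1) / (alpha S * pS S))
  + (1 - alpha S) * (1 - theta S) / (alpha S * theta S) * sigmaRD2 S k * pS S
    * (sigmaSR2 S k + \sum_(i < K) betaSR S i)
  + (1 - theta S) * pS S * (\sum_(i < K) (sigmaSR2 S i ^+ 2 * sigmaRD2 S i))
    / (theta S * pR * sigmaSR2 S k * sigmaRD2 S k).

(* The formula has p_R in denominators, so the value at p_R = 0 is imposed: it
   is the limit 0, not what the convention 0^-1 = 0 would produce.  Only
   arguments 0 <= pR are meaningful. *)
Definition rate (R : realType) (K : nat) (S : relay_system R K)
    (pR : R) (k : 'I_K) : R :=
  if pR == 0 then 0 else
  (tauc S - 2 * taup S) / tauc S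
  * log2 (1 + termA S k
              / (termB S k + termC S k + termD S pR k + termE S k
                 + termF S pR k + termG S pR k + termH S pR k)).

Definition sum_rate (R : realType) (K : nat) (S : relay_system R K)
    (pR : R) : R :=
  \sum_(k < K) rate S pR k.

Definition is_maximizer_nneg (R : realType) (f : R -> R) (p : R) : Prop :=
  0 <= p /\ forall q : R, 0 <= q -> f q <= f p.

(* Main.v *)
(** With all large-scale fadings equal to 1, every [sigmaSR2 S i] and
    [sigmaRD2 S i] has a common value [s], and the denominator of the SINR of
    each user, as a function of the relay power [p], is a constant plus
    [s / theta * (sigmaLI2 / alpha * p + pS * K / p)].  By AM-GM this is
    minimal exactly at [p = sqrt (alpha * pS * K / sigmaLI2)], and the rate is
    strictly decreasing in the denominator. *)
Require Import Defs.
From HB Require Import structures.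
From mathcomp Require Import all_boot all_order all_algebra.
From mathcomp Require Import all_classical all_reals all_analysis.
From mathcomp Require Import ring lra.

Set Implicit Arguments.
Unset Strict Implicit.
Unset Printing Implicit Defensive.

Import Order.TTheory GRing.Theory Num.Theory.

Local Open Scope ring_scope.

Definition sinr_denom (R : realType) (K : nat) (S : relay_system R K)
    (p : R) (k : 'I_K) : R :=
  termB S k + termC S k + termD S p k + termE S k
  + termF S p k + termG S p k + termH S p k.

Lemma ltr_log2 (R : realType) (x y : R) : 0 < x -> x < y -> log2 x < log2 y.
Proof.
move=> x0 xy; rewrite /log2 ltr_pM2r; last by rewrite invr_gt0 ln_gt0 ?ltr1n.
by rewrite ltr_ln ?posrE // (lt_trans x0).
Qed.

Lemma log2_gt0 (R : realType) (x : R) : 1 < x -> 0 < log2 x.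
Proof. by move=> x1; rewrite divr_gt0 ?ln_gt0 ?ltr1n. Qed.

(* [done] goes first, so that the positivity hypotheses on [sigmaSR2] and
   [sigmaRD2] are used before these quotients get unfolded. *)
Ltac nonneg :=
  repeat first [done | apply: addr_ge0 | apply: mulr_ge0 | apply: exprn_ge0
                | rewrite invr_ge0].

Section Positivity.
Variables (R : realType) (K : nat) (S : relay_system R K).

Lemma alpha_gt0 : 0 < alpha S.
Proof. by case/andP: (alpha_range S). Qed.

Lemma theta_gt0 : 0 < theta S.
Proof. by case/andP: (theta_range S). Qed.

Lemma subr_alpha_ge0 : 0 <= 1 - alpha S.
Proof. by rewrite subr_ge0; case/andP: (alpha_range S). Qed.

Lemma subr_theta_ge0 : 0 <= 1 - theta S.
Proof. by rewrite subr_ge0; case/andP: (theta_range S). Qed.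

Lemma sigmaSR2_gt0 i : 0 < sigmaSR2 S i.
Proof.
have a0 := alpha_gt0; have p0 := pp_gt0 S; have t0 := taup_gt0 S.
have b0 := betaSR_gt0 S i.
by rewrite divr_gt0 ?addr_gt0 ?mulr_gt0 ?exprn_gt0.
Qed.

Lemma sigmaRD2_gt0 i : 0 < sigmaRD2 S i.
Proof.
have a0 := alpha_gt0; have p0 := pp_gt0 S; have t0 := taup_gt0 S.
have b0 := betaRD_gt0 S i.
by rewrite divr_gt0 ?addr_gt0 ?mulr_gt0 ?exprn_gt0.
Qed.

Lemma termA_gt0 k : 0 < termA S k.
Proof.
have M0 : 0 < (M S)%:R :> R by rewrite ltr0n; exact: M_ge1.
apply: mulr_gt0; last exact: sigmaRD2_gt0.
apply: mulr_gt0; last exact: sigmaSR2_gt0.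
exact: mulr_gt0 (pS_gt0 S) M0.
Qed.

Lemma prelog_gt0 : 0 < (tauc S - 2 * taup S) / tauc S.
Proof.
have t0 := taup_gt0 S; have t1 := tauc_gt S.
by rewrite divr_gt0 // ?subr_gt0 //; lra.
Qed.

(** Strictness comes from [termE] alone. The other terms are nonnegative, which is where
    [alpha <= 1] and [theta <= 1] enter. *)
Lemma sinr_denom_gt0 p k : 0 < p -> 0 < sinr_denom S p k.
Proof.
move=> p0; have L0 := ltW (sigmaLI2_gt0 S); have pS0 := ltW (pS_gt0 S).
have a0 := ltW alpha_gt0; have t0 := ltW theta_gt0; have pw := ltW p0.
have a1 := subr_alpha_ge0; have t1 := subr_theta_ge0.
have sS i := ltW (sigmaSR2_gt0 i); have sD i := ltW (sigmaRD2_gt0 i).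
have bS i := ltW (betaSR_gt0 S i); have bD i := ltW (betaRD_gt0 S i).
have sumS : 0 <= \sum_(i < K) betaSR S i by apply: sumr_ge0.
have sumD : 0 <= \sum_(i < K) sigmaRD2 S i by apply: sumr_ge0.
have sumG : 0 <= \sum_(i < K) (sigmaSR2 S i ^+ 2 * sigmaRD2 S i).
  by apply: sumr_ge0 => i _; nonneg.
have M0 : 0 <= (M S)%:R :> R by rewrite ler0n.
have B0 : 0 <= termB S k by rewrite /termB; nonneg.
have C0 : 0 <= termC S k.
  rewrite /termC mulr_ge0 // sumr_ge0 // => j _.
  by nonneg.
have D0 : 0 <= termD S p k by rewrite /termD; nonneg.
have E0 : 0 < termE S k by exact: sigmaRD2_gt0.
have F0 : 0 <= termF S p k.
  by rewrite /termF; nonneg.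
have G0 : 0 <= termG S p k by rewrite /termG; nonneg.
have H0 : 0 <= termH S p k.
  by rewrite /termH; nonneg.
by rewrite /sinr_denom; lra.
Qed.

(** Serves to exclude zero power as a maximizer, since the rate is set to 0 there. *)
Lemma rate_gt0 p k : 0 < p -> 0 < rate S p k.
Proof.
move=> p0; rewrite /rate gt_eqF // mulr_gt0 ?prelog_gt0 // log2_gt0 //.
by rewrite ltrDl divr_gt0 ?termA_gt0 ?sinr_denom_gt0.
Qed.

(** The prelog factor and [termA] are positive and do not depend on the relay power, so rates
    compare through the denominators. *)
Lemma ltr_rate p q k : 0 < p -> 0 < q ->
  sinr_denom S p k < sinr_denom S q k -> rate S q k < rate S p k.
Proof.
move=> p0 q0 lt_pq; rewrite /rate !gt_eqF // ltr_pM2l ?prelog_gt0 //.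
have A0 := termA_gt0 k.
have d0 := sinr_denom_gt0 k p0; have e0 := sinr_denom_gt0 k q0.
rewrite ltr_log2 ?addr_gt0 ?divr_gt0 // ltrD2l ltr_pM2l //.
by rewrite ltf_pV2 ?posrE.
Qed.

End Positivity.

Section Homogeneous.
Variables (R : realType) (K : nat) (S : relay_system R K).
Hypotheses (hSR : forall k : 'I_K, betaSR S k = 1)
           (hRD : forall k : 'I_K, betaRD S k = 1).

Let P := Num.sqrt (alpha S * pS S * K%:R / sigmaLI2 S).

(** In the difference, all contributions free of the power cancel and need no evaluation. The linear
    parts of [termD], [termF], [termH] combine by 1 + (1 - alpha)/alpha + (1 - theta)/(alpha theta)
    = 1/(alpha theta), the inverse parts of [termG], [termH] by 1 + (1 - theta)/theta = 1/theta. *)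
Lemma sinr_denomB p q k : 0 < p -> 0 < q ->
  sinr_denom S q k - sinr_denom S p k =
  sigmaRD2 S k / theta S *
  (sigmaLI2 S / alpha S * (q - p) + pS S * K%:R * (q^-1 - p^-1)).
Proof.
move=> p0 q0; have s0 := sigmaRD2_gt0 S k; set s := sigmaRD2 S k in s0 *.
have eS i : sigmaSR2 S i = s by rewrite /s /sigmaSR2 /sigmaRD2 hSR hRD.
have eD i : sigmaRD2 S i = s by rewrite /s /sigmaRD2 !hRD.
have eG : \sum_(i < K) (sigmaSR2 S i ^+ 2 * sigmaRD2 S i) = K%:R * s ^+ 3.
  under eq_bigr => i _ do rewrite eS eD -exprSr.
  by rewrite sumr_const card_ord mulr_natl.
rewrite /sinr_denom /termD /termF /termG /termH eG eS !eD.
have a0 := lt0r_neq0 (alpha_gt0 S); have t0 := lt0r_neq0 (theta_gt0 S).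
have pS0 := lt0r_neq0 (pS_gt0 S).
field.
by rewrite ?a0 ?t0 ?pS0 ?(lt0r_neq0 s0) ?(lt0r_neq0 p0) ?(lt0r_neq0 q0).
Qed.

Lemma opt_power_gt0 : 0 < P.
Proof.
rewrite sqrtr_gt0 divr_gt0 ?sigmaLI2_gt0 // !mulr_gt0 ?alpha_gt0 ?pS_gt0 //.
by rewrite ltr0n (K_ge1 S).
Qed.

Lemma sinr_denom_opt_lt q k : 0 < q -> q != P ->
  sinr_denom S P k < sinr_denom S q k.
Proof.
move=> q0 qP; have P0 := opt_power_gt0; have L0 := sigmaLI2_gt0 S.
have a0 := alpha_gt0 S.
have PE : pS S * K%:R = sigmaLI2 S / alpha S * P ^+ 2.
  (* The radicand is positive because its root [P] is. *)
  rewrite sqr_sqrtr; last by rewrite ltW // -sqrtr_gt0.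
  by field; rewrite (lt0r_neq0 a0) (lt0r_neq0 L0).
rewrite -subr_gt0 sinr_denomB // PE.
(* The AM-GM gap in exact form: q - P + P^2 (1/q - 1/P) = (q - P)^2 / q. *)
have -> : sigmaLI2 S / alpha S * (q - P)
    + sigmaLI2 S / alpha S * P ^+ 2 * (q^-1 - P^-1)
    = sigmaLI2 S / alpha S * ((q - P) ^+ 2 / q).
  by field; rewrite (lt0r_neq0 a0) (lt0r_neq0 q0) (lt0r_neq0 P0).
have sq0 : 0 < (q - P) ^+ 2 by rewrite lt0r sqrf_eq0 subr_eq0 qP sqr_ge0.
apply: mulr_gt0; first by rewrite divr_gt0 ?sigmaRD2_gt0 ?theta_gt0.
by apply: mulr_gt0; rewrite divr_gt0.
Qed.

Lemma rate_opt_lt q k : 0 <= q -> q != P -> rate S q k < rate S P k.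
Proof.
rewrite le0r => /predU1P[-> _|q0 qP].
  by rewrite {1}/rate eqxx rate_gt0 ?opt_power_gt0.
by apply: ltr_rate => //; [exact: opt_power_gt0 | exact: sinr_denom_opt_lt].
Qed.

Lemma sum_rate_opt_lt q : 0 <= q -> q != P -> sum_rate S q < sum_rate S P.
Proof.
move=> q0 qP; apply: ltr_sum => [|k _]; last exact: rate_opt_lt.
(* A strict inequality between sums needs at least one user. *)
by apply/hasP; exists (Ordinal (K_ge1 S)); rewrite ?mem_index_enum.
Qed.

End Homogeneous.

Theorem corollary3 (R : realType) (K : nat) (S : relay_system R K)
    (hSR : forall k : 'I_K, betaSR S k = 1)
    (hRD : forall k : 'I_K, betaRD S k = 1) :
  forall p : R,
    is_maximizer_nneg (sum_rate S) p <->
    p = Num.sqrt (alpha S * pS S * K%:R / sigmaLI2 S).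
Proof.
move=> p; split=> [[p0 pmax] | ->].
  (* Uniqueness: any other maximizer would be strictly beaten by the square root. *)
  apply/eqP/negP => /negP pP.
  have := sum_rate_opt_lt hSR hRD p0 pP.
  by rewrite ltNge pmax ?sqrtr_ge0.
split=> [|q q0]; first exact: sqrtr_ge0.
have [-> //|qP] := eqVneq q (Num.sqrt (alpha S * pS S * K%:R / sigmaLI2 S)).
exact: ltW (sum_rate_opt_lt hSR hRD q0 qP).
Qed.
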